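(* Let $P$ be a simple orthogonal polygon (all edges horizontal or vertical), viewed as a closed track. A human and a puppy are points on the boundary of $P$. The human walks along the boundary at bounded speed and may change direction. Whenever the Euclidean straight-line distance from the puppy to the human can be decreased by moving the puppy along the track in some direction, the puppy runs (with unbounded speed, the human stationary) in such a direction, until it reaches a point of the track where this distance is locally minimal; while the configuration is locally minimal and the human moves, the puppy moves along the track so as to stay at a local minimum until it is forced to run again. The human catches the puppy when their positions coincide. Then, from any initial configuration, the human can catch the puppy by walking counterclockwise around $P$ at most twice. *)

(* Defs.v *)
From Stdlib Require Import Reals Lra Lia.
Open Scope R_scope.

Definition pt : Type := (R * R)%type.

Definition edist (a b : pt) : R :=
  sqrt ((fst a - fst b) ^ 2 + (snd a - snd b) ^ 2).

(* [gamma] is an arc-length parametrisation (period [L]) of the boundary of a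
   simple orthogonal polygon, traversed counterclockwise:
   - gamma is L-periodic and injective on [0, L) (simple closed curve);
   - there are breakpoints 0 = tb 0 < tb 1 < ... < tb n = L such that on each
     [tb i, tb (i+1)] gamma moves at unit speed in an axis-parallel direction
     (all edges horizontal or vertical);
   - the shoelace signed area of the vertex sequence gamma (tb i) is positive
     (counterclockwise orientation). *)
Definition ccw_simple_orthogonal_polygon (L : R) (gamma : R -> pt) : Prop :=
  0 < L /\
  (forall t, gamma (t + L) = gamma t) /\
  (forall t1 t2, 0 <= t1 < L -> 0 <= t2 < L -> gamma t1 = gamma t2 -> t1 = t2) /\
  exists (n : nat) (tb : nat -> R),
    tb 0%nat = 0 /\ tb n = L /\
    (forall i, (i < n)%nat -> tb i < tb (S i)) /\
    (forall i, (i < n)%nat ->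
       exists dx dy : R,
         ((dx = 0 /\ (dy = 1 \/ dy = -1)) \/ (dy = 0 /\ (dx = 1 \/ dx = -1))) /\
         forall t, tb i <= t <= tb (S i) ->
           gamma t = (fst (gamma (tb i)) + (t - tb i) * dx,
                      snd (gamma (tb i)) + (t - tb i) * dy)) /\
    0 < sum_f_R0 (fun i => fst (gamma (tb i)) * snd (gamma (tb (S i)))
                          - fst (gamma (tb (S i))) * snd (gamma (tb i)))
                 (pred n).

Definition track_local_min (gamma : R -> pt) (x : pt) (q : R) : Prop :=
  exists eps, 0 < eps /\
    forall u, Rabs u < eps -> edist x (gamma q) <= edist x (gamma (q + u)).

(* A joint evolution of human and puppy, parametrised by tau in [0,1] (the
   instantaneous runs of the puppy are stretched into intervals of tau during
   which the human stands still).  [s tau] and [p tau] are (lifted) track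
   parameters of the human and of the puppy.
   - both move continuously along the track;
   - the human walks counterclockwise only (s nondecreasing);
   - whenever the puppy is not at a local minimum of the distance to the human,
     it runs: for a while the human stays put and the puppy moves strictly
     monotonically in one direction along the track with the distance to the
     human strictly decreasing.  (Hence a run keeps its direction and ends
     exactly at the first local minimum; at all other times the puppy sits at a
     local minimum and follows it continuously.) *)
Definition valid_chase (gamma : R -> pt) (s p : R -> R) : Prop :=
  continuity s /\ continuity p /\
  (forall a b, 0 <= a -> a <= b -> b <= 1 -> s a <= s b) /\
  (forall tau, 0 <= tau < 1 ->
     ~ track_local_min gamma (gamma (s tau)) (p tau) ->
     exists delta, 0 < delta /\
       exists dir : R, (dir = 1 \/ dir = -1) /\
         forall a b, tau <= a -> a < b -> b <= tau + delta -> b <= 1 ->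
           s a = s tau /\ s b = s tau /\
           dir * p a < dir * p b /\
           edist (gamma (s tau)) (gamma (p b)) < edist (gamma (s tau)) (gamma (p a))).

(* Main.v *)
Require Import Defs.
From Stdlib Require Import Reals Lra Lia Classical.
Open Scope R_scope.

(** The track is cut at a vertex which the puppy cannot pass forwards.  Let [a b] be the
    bottom edge, with [b] the rightmost of the lowest points, and suppose it is traversed from
    left to right, so that the track descends into [a].  A puppy just before [a] is
    attracted backwards as soon as the human is strictly above the bottom line; if the human is
    on the bottom line, it is either to the left of [a], which keeps the puppy from moving
    onto [a b], or on [a b] itself, and then the puppy runs straight into the human.  As an
    uncaught puppy stays strictly between the human and the human's next lap, a puppy that
    never passes [a] is caught before the human completes two laps.

    If the rightmost bottom edge is traversed from right to left, the mirror image of the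
    argument applies to the leftmost bottom edge, unless that one is traversed from left to
    right.  This last case contradicts simplicity, by a winding number count. *)

(** * Induction along a real interval and continuous functions *)

(** Let [m] be the supremum of the points up to which [P] holds throughout. The limit hypothesis
    gives [P m], and the extension hypothesis excludes [m < b]. *)
Lemma real_induction (P : R -> Prop) (a b : R) :
  a <= b -> P a ->
  (forall t, a <= t < b -> P t ->
     exists d, 0 < d /\ forall u, t < u <= t + d -> u <= b -> P u) ->
  (forall t, a < t <= b -> (forall u, a <= u < t -> P u) -> P t) ->
  forall t, a <= t <= b -> P t.
Proof.
  intros Hab Ha Hext Hcl.
  set (E := fun t => a <= t <= b /\ forall u, a <= u <= t -> P u).
  assert (HEa : E a).
  { split; [lra|]. intros u Hu. replace u with a by lra. exact Ha. }
  destruct (completeness E) as [m [Hub Hlub]].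
  { exists b. intros t [Ht _]. lra. }
  { exists a. exact HEa. }
  assert (Ham : a <= m) by (apply Hub; exact HEa).
  assert (Hmb : m <= b) by (apply Hlub; intros t [Ht _]; lra).
  assert (Hbelow : forall u, a <= u < m -> P u).
  { intros u Hu. apply NNPP. intros HnP.
    assert (m <= u); [|lra].
    apply Hlub. intros t [Ht HP]. apply Rnot_lt_le. intros Hut.
    apply HnP, HP. lra. }
  assert (Hm : P m).
  { destruct (Req_dec a m) as [<-|Hne]; [exact Ha|].
    apply Hcl; [lra|exact Hbelow]. }
  assert (m = b) as ->.
  { apply NNPP. intros Hne.
    destruct (Hext m) as [d [Hd HP]]; [lra|exact Hm|].
    assert (Rmin (m + d) b <= m).
    { apply Hub. split.
      - split; [apply Rmin_glb; lra|apply Rmin_r].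
      - intros u Hu. destruct (Rlt_le_dec u m); [apply Hbelow; lra|].
        destruct (Req_dec u m) as [->|]; [exact Hm|].
        pose proof (Rmin_l (m + d) b). pose proof (Rmin_r (m + d) b).
        apply HP; lra. }
    unfold Rmin in *. destruct (Rle_dec (m + d) b); lra. }
  intros t Ht. destruct (Req_dec t b) as [->|]; [exact Hm|apply Hbelow; lra].
Qed.

Lemma continuity_lt_near (f : R -> R) (t c : R) :
  continuity f -> f t < c ->
  exists d, 0 < d /\ forall u, Rabs (u - t) <= d -> f u < c.
Proof.
  intros Hf Hc. destruct (Hf t (c - f t)) as [d [Hd H]]; [lra|].
  exists (d / 2). split; [lra|]. intros u Hu.
  destruct (Req_dec u t) as [->|Hne]; [exact Hc|].
  assert (Hlt : Rabs (f u - f t) < c - f t).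
  { apply (H u). split; [split; [exact I|auto]|]. simpl. unfold Rdist. lra. }
  apply Rabs_def2 in Hlt. lra.
Qed.

Lemma continuity_gt_near (f : R -> R) (t c : R) :
  continuity f -> c < f t ->
  exists d, 0 < d /\ forall u, Rabs (u - t) <= d -> c < f u.
Proof.
  intros Hf Hc.
  destruct (continuity_lt_near (- f)%F t (- c)) as [d [Hd H]].
  - apply continuity_opp. exact Hf.
  - unfold opp_fct. lra.
  - exists d. split; [exact Hd|]. intros u Hu. specialize (H u Hu).
    unfold opp_fct in H. lra.
Qed.

Lemma continuity_limit_le (f : R -> R) (a t c : R) :
  continuity f -> a < t -> (forall u, a <= u < t -> f u <= c) -> f t <= c.
Proof.
  intros Hf Hat H. apply Rnot_lt_le. intros Hc.
  destruct (continuity_gt_near f t c Hf Hc) as [d [Hd Hu]].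
  pose proof (Rmax_l a (t - d)). pose proof (Rmax_r a (t - d)).
  assert (Rmax a (t - d) < t) by (apply Rmax_lub_lt; lra).
  assert (c < f (Rmax a (t - d))).
  { apply Hu. rewrite Rabs_left; lra. }
  assert (f (Rmax a (t - d)) <= c) by (apply H; lra).
  lra.
Qed.

Lemma continuity_limit_ge (f : R -> R) (a t c : R) :
  continuity f -> a < t -> (forall u, a <= u < t -> c <= f u) -> c <= f t.
Proof.
  intros Hf Hat H.
  assert (Hle : (- f)%F t <= - c); [|unfold opp_fct in Hle; lra].
  apply (continuity_limit_le _ a).
  - apply continuity_opp. exact Hf.
  - exact Hat.
  - intros u Hu. specialize (H u Hu). unfold opp_fct. lra.
Qed.

Lemma continuity_stays_below (f : R -> R) (a b c : R) :
  continuity f -> f a < c -> (forall t, a <= t <= b -> f t <> c) ->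
  forall t, a <= t <= b -> f t < c.
Proof.
  intros Hf Ha Hne t Ht.
  apply (real_induction (fun t => f t < c) a b); [lra|exact Ha| | |exact Ht].
  - intros w Hw Hlt. destruct (continuity_lt_near f w c Hf Hlt) as [d [Hd H]].
    exists d. split; [exact Hd|]. intros u Hu _. apply H. rewrite Rabs_right; lra.
  - intros w Hw Hlt.
    assert (f w <= c).
    { apply (continuity_limit_le f a); [exact Hf|lra|].
      intros u Hu. left. apply Hlt. exact Hu. }
    assert (f w <> c) by (apply Hne; lra). lra.
Qed.

(** The first decrease brings [f] strictly below [f u] at some [w]; real induction from [w] then
    keeps [f] at or below [f w]. It turns short runs of the puppy into a comparison over a whole
    time interval. *)
Lemma locally_decreasing_lt (f : R -> R) (u v : R) :
  continuity f -> u < v ->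
  (forall t, u <= t < v -> f t <= f u ->
     exists d, 0 < d /\ forall t', t < t' <= t + d -> t' <= v -> f t' < f t) ->
  f v < f u.
Proof.
  intros Hf Huv Hdec.
  destruct (Hdec u) as [d [Hd Hu]]; [lra|lra|].
  set (w := Rmin (u + d) v).
  assert (Hw : u < w /\ w <= u + d /\ w <= v).
  { unfold w, Rmin. destruct (Rle_dec (u + d) v); lra. }
  assert (Hfw : f w < f u) by (apply Hu; lra).
  assert (f v <= f w); [|lra].
  apply (real_induction (fun t => f t <= f w) w v); [lra|lra| | |lra].
  - intros t Ht Hle. destruct (Hdec t) as [e [He H]]; [lra|lra|].
    exists e. split; [exact He|]. intros t' Ht' Hv.
    specialize (H t' Ht' Hv). lra.
  - intros t Ht Hle. apply (continuity_limit_le f w); [exact Hf|lra|exact Hle].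
Qed.

Lemma last_time_below (f : R -> R) (t u c : R) :
  continuity f -> t <= u -> f t <= c -> c < f u ->
  exists w, t <= w < u /\ f w <= c /\ forall w', w < w' <= u -> c < f w'.
Proof.
  intros Hf Htu Ht Hu.
  destruct (completeness (fun w => t <= w <= u /\ f w <= c)) as [m [Hub Hlub]].
  { exists u. intros w [Hw _]. lra. }
  { exists t. lra. }
  assert (t <= m) by (apply Hub; lra).
  assert (m <= u) by (apply Hlub; intros w [Hw _]; lra).
  assert (Hm : f m <= c).
  { apply Rnot_lt_le. intros Hc.
    destruct (continuity_gt_near f m c Hf Hc) as [d [Hd H']].
    assert (m <= m - d); [|lra].
    apply Hlub. intros w [Hw Hfw]. apply Rnot_lt_le. intros Hlt.
    assert (w <= m) by (apply Hub; split; [exact Hw|exact Hfw]).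
    assert (c < f w); [|lra]. apply H'. rewrite Rabs_left1; lra. }
  exists m. split; [|split].
  - split; [lra|]. destruct (Req_dec m u) as [->|]; lra.
  - exact Hm.
  - intros w' Hw'. apply Rnot_le_lt. intros Hle.
    assert (w' <= m); [|lra]. apply Hub. split; [lra|exact Hle].
Qed.

(** * Distance comparisons and the direction of a run *)

Lemma edist_le (x a b : pt) :
  (fst x - fst a) ^ 2 + (snd x - snd a) ^ 2 <=
  (fst x - fst b) ^ 2 + (snd x - snd b) ^ 2 ->
  edist x a <= edist x b.
Proof. intros H. apply sqrt_le_1_alt. exact H. Qed.

Lemma edist_lt (x a b : pt) :
  (fst x - fst a) ^ 2 + (snd x - snd a) ^ 2 <
  (fst x - fst b) ^ 2 + (snd x - snd b) ^ 2 ->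
  edist x a < edist x b.
Proof.
  intros H. apply sqrt_lt_1_alt. split; [|exact H].
  pose proof (pow2_ge_0 (fst x - fst a)). pose proof (pow2_ge_0 (snd x - snd a)). lra.
Qed.

(** The strict decrease on the [sg] side rules out a local minimum, so a run begins. By continuity
    its initial part stays within [c] of [p tau]; were it directed against [sg], the distance would
    have to drop where it is at least its initial value. *)
Lemma run_direction (g : R -> pt) (s p : R -> R) (tau sg c : R) :
  valid_chase g s p -> 0 <= tau < 1 -> sg = 1 \/ sg = -1 -> 0 < c ->
  (forall u, 0 < u < c ->
     edist (g (s tau)) (g (p tau)) <= edist (g (s tau)) (g (p tau - sg * u))) ->
  (forall u, 0 < u < c ->
     edist (g (s tau)) (g (p tau + sg * u)) < edist (g (s tau)) (g (p tau))) ->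
  exists d, 0 < d /\ forall t, tau < t <= tau + d -> t <= 1 ->
    s t = s tau /\ 0 < sg * (p t - p tau).
Proof.
  intros [_ [Hp [_ Hrun]]] Htau Hsg Hc Hbad Hgood.
  destruct (Hrun tau Htau) as [d [Hd [dir [Hdir H]]]].
  { intros [eps [Heps Hmin]].
    assert (Hu : 0 < Rmin eps c / 2 < eps /\ Rmin eps c / 2 < c).
    { unfold Rmin. destruct (Rle_dec eps c); lra. }
    assert (Hlt := Hgood (Rmin eps c / 2) ltac:(lra)).
    assert (Hge : edist (g (s tau)) (g (p tau)) <=
                  edist (g (s tau)) (g (p tau + sg * (Rmin eps c / 2)))).
    { apply Hmin. destruct Hsg as [-> | ->];
        [rewrite Rabs_right|rewrite Rabs_left]; lra. }
    lra. }
  destruct (continuity_lt_near p tau (p tau + c) Hp ltac:(lra)) as [d1 [Hd1 Hup]].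
  destruct (continuity_gt_near p tau (p tau - c) Hp ltac:(lra)) as [d2 [Hd2 Hlo]].
  assert (Hdd : dir = sg).
  { apply NNPP. intros Hne.
    assert (Hopp : dir = - sg) by (destruct Hsg, Hdir; lra). subst dir.
    set (t := Rmin (Rmin (tau + d1) (tau + d2)) (Rmin (tau + d) 1)).
    assert (Ht : tau < t /\ t <= tau + d1 /\ t <= tau + d2 /\ t <= tau + d /\ t <= 1).
    { unfold t, Rmin. repeat destruct (Rle_dec _ _); lra. }
    destruct (H tau t) as [_ [_ [Hmono Hdec]]]; [lra|lra|lra|lra|].
    specialize (Hup t). specialize (Hlo t).
    rewrite Rabs_right in Hup, Hlo by lra.
    specialize (Hup ltac:(lra)). specialize (Hlo ltac:(lra)).
    assert (Hge := Hbad (sg * (p tau - p t))).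
    replace (p tau - sg * (sg * (p tau - p t))) with (p t) in Hge
      by (destruct Hsg as [-> | ->]; ring).
    assert (0 < sg * (p tau - p t) < c) by (destruct Hsg as [-> | ->]; lra).
    specialize (Hge ltac:(lra)). lra. }
  subst dir. exists d. split; [exact Hd|]. intros t Ht Ht1.
  destruct (H tau t) as [_ [Hst [Hmono _]]]; [lra|lra|lra|lra|].
  split; [exact Hst|]. lra.
Qed.

(** * A vertex that the puppy cannot pass *)

(** The track comes straight down into [a] and leaves to the right along the bottom line until [b].
    The field [bar_right] ensures that a human on the bottom line and not left of [a] stands on this
    very segment. *)
Record barrier (g : R -> pt) (a b eta : R) : Prop := {
  bar_len : a < b;
  bar_eta : 0 < eta;
  bar_in : forall t, a - eta <= t <= a -> g t = (fst (g a), snd (g a) + (a - t));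
  bar_out : forall t, a <= t <= b -> g t = (fst (g a) + (t - a), snd (g a));
  bar_low : forall t, snd (g a) <= snd (g t);
  bar_right : forall t, snd (g t) = snd (g a) -> fst (g t) <= fst (g b)
}.

(** Real induction in time. The hypothesis on [s tau < s 1] excludes a chase that ends while the
    puppy is still running from [a] towards a human who no longer moves. *)
Lemma barrier_not_crossed (g : R -> pt) (s p : R -> R) (a b eta : R) :
  continuity (fun t => fst (g t)) -> continuity (fun t => snd (g t)) ->
  barrier g a b eta -> valid_chase g s p ->
  (forall tau, 0 <= tau <= 1 -> g (s tau) <> g (p tau)) ->
  p 0 < a ->
  (forall tau, 0 <= tau <= 1 -> p tau = a -> s tau < s 1) ->
  forall tau, 0 <= tau <= 1 -> p tau <= a.
Proof.
  intros Hgx Hgy [Hab Heta Hin Hout Hlow Hright] Hv Hnc Hp0 Hs1 tau Htau.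
  pose proof Hv as [Hs [Hp _]].
  set (X := fun t => fst (g (s t))). set (Y := fun t => snd (g (s t))).
  assert (HX : continuity X) by exact (continuity_comp s _ Hs Hgx).
  assert (HY : continuity Y) by exact (continuity_comp s _ Hs Hgy).
  set (xa := fst (g a)) in *. set (ya := snd (g a)) in *.
  (* The bound [p tau <= a] alone is not inductive: at [a] it is the human lying strictly to the
     left that keeps the puppy off the bottom segment. *)
  enough (p tau < a \/ (p tau = a /\ X tau < xa)) by lra.
  apply (real_induction (fun t => p t < a \/ (p t = a /\ X t < xa)) 0 1);
    [lra|left; exact Hp0| | |exact Htau]; clear tau Htau.
  - intros t Ht [Hpt|[Hpt HXt]].
    { destruct (continuity_lt_near p t a Hp Hpt) as [d [Hd H]].
      exists d. split; [exact Hd|]. intros u Hu _. left. apply H.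
      rewrite Rabs_right; lra. }
    destruct (continuity_lt_near X t xa HX HXt) as [d1 [Hd1 H1]].
    destruct (continuity_lt_near p t b Hp ltac:(lra)) as [d2 [Hd2 H2]].
    exists (Rmin d1 d2). split; [apply Rmin_pos; lra|].
    pose proof (Rmin_l d1 d2). pose proof (Rmin_r d1 d2).
    intros u Hu Hu1.
    assert (HXu : forall w, t <= w <= u -> X w < xa)
      by (intros w Hw; apply H1; rewrite Rabs_right; lra).
    assert (Hpu : forall w, t <= w <= u -> p w < b)
      by (intros w Hw; apply H2; rewrite Rabs_right; lra).
    assert (p u <= a); [|specialize (HXu u); lra].
    (* Otherwise, after the last time [w] with [p w <= a], the puppy is inside the bottom segment
       with the human to its left, so it keeps running backwards. This gives [p u < p w'] for a time
       [w'] so close to [w] that [p w' < p u]. *)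
    apply Rnot_lt_le. intros Hgt.
    destruct (last_time_below p t u a Hp) as [w [Hw [Hpw Haft]]]; [lra|lra|lra|].
    destruct (continuity_lt_near p w (p u) Hp ltac:(lra)) as [d [Hd H']].
    set (w' := Rmin (w + d) ((w + u) / 2)).
    assert (Hw' : w < w' /\ w' <= w + d /\ w' < u).
    { unfold w', Rmin. destruct (Rle_dec (w + d) ((w + u) / 2)); lra. }
    specialize (H' w'). rewrite Rabs_right in H' by lra. specialize (H' ltac:(lra)).
    assert (p u < p w'); [|lra].
    apply locally_decreasing_lt; [exact Hp|lra|].
    intros r Hr _.
    assert (Har : a < p r) by (apply Haft; lra).
    assert (Hrb : p r < b) by (apply Hpu; lra).
    assert (HXr : X r < xa) by (apply HXu; lra).
    destruct (run_direction g s p r (-1) (Rmin (b - p r) (p r - a))) as [e [He Hrun]];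
      [exact Hv|lra|lra|apply Rmin_pos; lra| | |].
    { intros q Hq. pose proof (Rmin_l (b - p r) (p r - a)).
      pose proof (Rmin_r (b - p r) (p r - a)).
      apply edist_le. rewrite (Hout (p r)), (Hout (p r - -1 * q)) by lra.
      simpl fst. simpl snd. fold (X r) (Y r). nra. }
    { intros q Hq. pose proof (Rmin_l (b - p r) (p r - a)).
      pose proof (Rmin_r (b - p r) (p r - a)).
      apply edist_lt. rewrite (Hout (p r)), (Hout (p r + -1 * q)) by lra.
      simpl fst. simpl snd. fold (X r) (Y r). nra. }
    exists e. split; [exact He|]. intros t' Ht' Ht'u.
    destruct (Hrun t'); lra.
  - intros t Ht Hbef.
    assert (Hpt : p t <= a).
    { apply (continuity_limit_le p 0); [exact Hp|lra|].
      intros u Hu. destruct (Hbef u Hu); lra. }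
    destruct (Rlt_le_dec (p t) a) as [|Hpa]; [left; assumption|right].
    assert (Hpta : p t = a) by lra. split; [exact Hpta|].
    apply Rnot_le_lt. intros HXt.
    destruct (Rle_lt_or_eq_dec ya (Y t) (Hlow (s t))) as [HYt|HYt].
    (* Human strictly above the bottom line. Shortly before [t] the puppy is within [c / 2] of [a],
       hence on the descent and lower than the human, so it is drawn back up. It would then have
       been beyond [a] just before, against the induction hypothesis. *)
    + set (c := Rmin eta (Y t - ya)).
      assert (Hc : 0 < c) by (apply Rmin_pos; lra).
      assert (Hce : c <= eta) by apply Rmin_l. assert (HcY : c <= Y t - ya) by apply Rmin_r.
      destruct (continuity_gt_near Y t (ya + c / 2) HY ltac:(lra)) as [d1 [Hd1 H1]].
      destruct (continuity_gt_near p t (a - c / 2) Hp ltac:(lra)) as [d2 [Hd2 H2]].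
      set (u := Rmax 0 (t - Rmin d1 d2)).
      assert (Hu : 0 <= u < t /\ t - d1 <= u /\ t - d2 <= u).
      { pose proof (Rmin_l d1 d2). pose proof (Rmin_r d1 d2).
        assert (0 < Rmin d1 d2) by (apply Rmin_pos; lra).
        unfold u, Rmax. destruct (Rle_dec 0 (t - Rmin d1 d2)); lra. }
      assert (p t < p u); [|destruct (Hbef u); lra].
      apply locally_decreasing_lt; [exact Hp|lra|].
      intros r Hr _.
      assert (HYr : ya + c / 2 < Y r) by (apply H1; rewrite Rabs_left; lra).
      assert (Hpr : a - c / 2 < p r) by (apply H2; rewrite Rabs_left; lra).
      assert (Hrun : exists e, 0 < e /\ forall t', r < t' <= r + e -> t' <= 1 ->
                s t' = s r /\ 0 < -1 * (p t' - p r)).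
      { destruct (Hbef r ltac:(lra)) as [Hra|[Hra HXr]].
        - set (e := Rmin (a - p r) (Rmin (c / 2) (Y r - (ya + (a - p r))))).
          assert (He : 0 < e) by (repeat apply Rmin_pos; lra).
          assert (He1 : e <= a - p r) by apply Rmin_l.
          assert (He2 : e <= c / 2 /\ e <= Y r - (ya + (a - p r))).
          { split; (eapply Rle_trans; [apply Rmin_r|]); [apply Rmin_l|apply Rmin_r]. }
          apply (run_direction g s p r (-1) e); [exact Hv|lra|lra|exact He| |];
            intros q Hq.
          + apply edist_le. rewrite (Hin (p r)), (Hin (p r - -1 * q)) by lra.
            simpl fst. simpl snd. fold (X r) (Y r). nra.
          + apply edist_lt. rewrite (Hin (p r)), (Hin (p r + -1 * q)) by lra.
            simpl fst. simpl snd. fold (X r) (Y r). nra.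
        - apply (run_direction g s p r (-1) (Rmin (b - a) (c / 2)));
            [exact Hv|lra|lra|apply Rmin_pos; lra| |];
            intros q Hq; pose proof (Rmin_l (b - a) (c / 2));
            pose proof (Rmin_r (b - a) (c / 2)); rewrite Hra.
          + apply edist_le. rewrite (Hout (a - -1 * q)) by lra.
            simpl fst. simpl snd. fold (X r) (Y r) xa ya. nra.
          + apply edist_lt. rewrite (Hin (a + -1 * q)) by lra.
            simpl fst. simpl snd. fold (X r) (Y r) xa ya. nra. }
      destruct Hrun as [e [He Hrun]].
      exists e. split; [exact He|]. intros t' Ht' Htt.
      destruct (Hrun t'); lra.
    + assert (HXb : X t <= xa + (b - a)).
      { assert (Hb := Hright (s t) (eq_sym HYt)). rewrite (Hout b) in Hb by lra.
        exact Hb. }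
      (* Human on the bottom segment: [H] is its parameter there, which may differ from [s t]
         although the points agree. *)
      set (H := a + (X t - xa)).
      assert (HgH : g (s t) = g H).
      { rewrite (Hout H) by (unfold H; lra).
        rewrite (surjective_pairing (g (s t))). fold (X t) (Y t).
        rewrite <- HYt. f_equal. unfold H. ring. }
      destruct (Req_dec (X t) xa) as [HXe|HXne].
      { apply (Hnc t); [lra|]. rewrite HgH, Hpta. f_equal. unfold H. lra. }
      assert (HaH : a < H) by (unfold H; lra).
      assert (HHb : H <= b) by (unfold H; lra).
      assert (Hlt : s t < s 1) by (apply Hs1; lra).
      (* The puppy runs towards [H] while the human stands still. Reaching [H] would be a catch, so
         the run would have to last until time 1, against [s t < s 1]. *)
      enough (s 1 = s t /\ a <= p 1 < H) by lra.
      apply (real_induction (fun w => s w = s t /\ a <= p w < H) t 1);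
        [lra|lra| | |lra].
      * intros w Hw [Hsw Hpw].
        assert (HXw : fst (g (s w)) = xa + (H - a))
          by (rewrite Hsw; fold (X t); unfold H; lra).
        assert (HYw : snd (g (s w)) = ya) by (rewrite Hsw; symmetry; exact HYt).
        assert (Hrun : exists e, 0 < e /\ forall t', w < t' <= w + e -> t' <= 1 ->
                  s t' = s w /\ 0 < 1 * (p t' - p w)).
        { destruct (Req_dec (p w) a) as [Hwa|Hwa].
          - apply (run_direction g s p w 1 (Rmin eta (H - a)));
              [exact Hv|lra|lra|apply Rmin_pos; lra| |];
              intros q Hq; pose proof (Rmin_l eta (H - a));
              pose proof (Rmin_r eta (H - a)); rewrite Hwa.
            + apply edist_le. rewrite (Hin (a - 1 * q)) by lra.
              rewrite HXw, HYw. simpl fst. simpl snd. fold xa ya. nra.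
            + apply edist_lt. rewrite (Hout (a + 1 * q)) by lra.
              rewrite HXw, HYw. simpl fst. simpl snd. fold xa ya. nra.
          - apply (run_direction g s p w 1 (Rmin (p w - a) (H - p w)));
              [exact Hv|lra|lra|apply Rmin_pos; lra| |];
              intros q Hq; pose proof (Rmin_l (p w - a) (H - p w));
              pose proof (Rmin_r (p w - a) (H - p w)).
            + apply edist_le. rewrite (Hout (p w)), (Hout (p w - 1 * q)) by lra.
              rewrite HXw, HYw. simpl fst. simpl snd. nra.
            + apply edist_lt. rewrite (Hout (p w)), (Hout (p w + 1 * q)) by lra.
              rewrite HXw, HYw. simpl fst. simpl snd. nra. }
        destruct Hrun as [e [He Hrun]].
        destruct (continuity_lt_near p w H Hp ltac:(lra)) as [d [Hd Hd']].
        exists (Rmin d e). split; [apply Rmin_pos; lra|].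
        pose proof (Rmin_l d e). pose proof (Rmin_r d e).
        intros u Hu Hu1. destruct (Hrun u) as [Hsu Hpu]; [lra|lra|].
        assert (p u < H) by (apply Hd'; rewrite Rabs_right; lra).
        split; lra.
      * intros w Hw Hb'.
        assert (Hsw : s w = s t).
        { apply Rle_antisym.
          - apply (continuity_limit_le s t); [exact Hs|lra|].
            intros u Hu. destruct (Hb' u Hu). lra.
          - apply (continuity_limit_ge s t); [exact Hs|lra|].
            intros u Hu. destruct (Hb' u Hu). lra. }
        assert (a <= p w).
        { apply (continuity_limit_ge p t); [exact Hp|lra|].
          intros u Hu. destruct (Hb' u Hu). lra. }
        assert (p w <= H).
        { apply (continuity_limit_le p t); [exact Hp|lra|].
          intros u Hu. destruct (Hb' u Hu). lra. }
        assert (p w <> H).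
        { intros Heq. apply (Hnc w); [lra|]. rewrite Hsw, HgH, Heq. reflexivity. }
        split; [exact Hsw|lra].
Qed.

(** * Periodicity, and catching the puppy at a barrier *)

Lemma period_mult (g : R -> pt) (L : R) :
  (forall t, g (t + L) = g t) -> forall (k : Z) t, g (t + IZR k * L) = g t.
Proof.
  intros Hg k. induction k using Z.peano_ind; intros t.
  - f_equal. ring.
  - rewrite succ_IZR, <- (IHk t), <- (Hg (t + IZR k * L)). f_equal. ring.
  - rewrite <- (IHk t), <- Z.sub_1_r, minus_IZR.
    rewrite <- (Hg (t + (IZR k - 1) * L)). f_equal. ring.
Qed.

Lemma shift_into_period (L t c : R) :
  0 < L -> exists k : Z, c <= t + IZR k * L < c + L.
Proof.
  intros HL. destruct (archimed ((c - t) / L)) as [Hlo Hhi].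
  assert (Hq : (c - t) / L * L = c - t) by (field; lra).
  destruct (Rlt_le_dec (t + IZR (up ((c - t) / L)) * L) (c + L)) as [Hlt|Hge].
  - exists (up ((c - t) / L)). split; [nra|exact Hlt].
  - exists (up ((c - t) / L) - 1)%Z. rewrite minus_IZR. split; nra.
Qed.

Lemma barrier_shift (g : R -> pt) (L a b eta : R) (k : Z) :
  (forall t, g (t + L) = g t) -> barrier g a b eta ->
  barrier g (a + IZR k * L) (b + IZR k * L) eta.
Proof.
  intros Hg [Hab Heta Hin Hout Hlow Hright].
  pose proof (period_mult g L Hg) as Hk.
  split; rewrite ?Hk; try assumption; try lra.
  - intros t Ht. rewrite <- (Hk (- k)%Z t), opp_IZR.
    rewrite Hin by lra. f_equal. ring.
  - intros t Ht. rewrite <- (Hk (- k)%Z t), opp_IZR.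
    rewrite Hout by lra. f_equal. ring.
Qed.

(** Without a catch [s - p] never meets a multiple of [L], so it stays below the multiple
    [IZR k * L] lying above its initial value. A translate of the barrier within one period ahead of
    [p 0] holds the puppy to less than or exactly one lap, while the human gains two laps, which
    forces [s - p] past that multiple. *)
Lemma barrier_catches (L : R) (g : R -> pt) (a b eta : R) (s p : R -> R) :
  0 < L -> (forall t, g (t + L) = g t) ->
  continuity (fun t => fst (g t)) -> continuity (fun t => snd (g t)) ->
  barrier g a b eta -> valid_chase g s p -> s 1 = s 0 + 2 * L ->
  exists tau, 0 <= tau <= 1 /\ g (s tau) = g (p tau).
Proof.
  intros HL Hg Hgx Hgy Hbar Hv Hs1. apply NNPP. intros Hno.
  assert (Hnc : forall tau, 0 <= tau <= 1 -> g (s tau) <> g (p tau))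
    by (intros tau Ht Heq; apply Hno; exists tau; split; assumption).
  pose proof Hv as [Hs [Hp _]].
  pose proof (period_mult g L Hg) as Hk.
  destruct (shift_into_period L (p 0) (s 0) HL) as [k Hk0].
  assert (Hne : forall (m : Z) tau, 0 <= tau <= 1 -> s tau - p tau <> IZR m * L).
  { intros m tau Ht Heq. apply (Hnc tau Ht).
    rewrite <- (Hk m (p tau)). f_equal. lra. }
  assert (Hahead : forall tau, 0 <= tau <= 1 -> s tau - p tau < IZR k * L).
  { apply (continuity_stays_below (s - p)%F); unfold minus_fct.
    - apply continuity_minus; assumption.
    - specialize (Hne k 0 ltac:(lra)). lra.
    - intros t Ht. apply Hne. exact Ht. }
  (* Negating the parameters yields an interval open at its left end, so that the puppy starts
     strictly before the translated barrier. *)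
  destruct (shift_into_period L (- a) (- p 0 - L) HL) as [m Hm].
  assert (Hpb : p 0 < a + IZR (- m) * L <= p 0 + L) by (rewrite opp_IZR; lra).
  assert (Hbar' := barrier_shift g L a b eta (- m)%Z Hg Hbar).
  assert (p 1 <= a + IZR (- m) * L).
  { apply (barrier_not_crossed g s p _ _ eta Hgx Hgy Hbar' Hv Hnc); [lra| |lra].
    intros tau Ht Heq. specialize (Hahead tau Ht). lra. }
  specialize (Hahead 1 ltac:(lra)). lra.
Qed.

(** * Polygons as periodic edge sequences, and their reflection *)

Definition edge_dir (g : R -> pt) (T : nat -> R) (i : nat) (dx dy : R) : Prop :=
  forall t, T i <= t <= T (S i) ->
    g t = (fst (g (T i)) + (t - T i) * dx, snd (g (T i)) + (t - T i) * dy).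

(** The breakpoints are continued periodically to all natural indices, and injectivity is stated on
    every window of length [L], so that arcs through the starting point need no special
    treatment. *)
Record orth_loop (L : R) (g : R -> pt) (n : nat) (T : nat -> R) : Prop := {
  loop_pos : 0 < L;
  loop_size : (0 < n)%nat;
  loop_per : forall t, g (t + L) = g t;
  loop_inj : forall t u, t <= u < t + L -> g t = g u -> t = u;
  loop_start : T 0%nat = 0;
  loop_lt : forall i, T i < T (S i);
  loop_shift : forall i, T (i + n)%nat = T i + L;
  loop_edge : forall i, edge_dir g T i 1 0 \/ edge_dir g T i (-1) 0 \/
                        edge_dir g T i 0 1 \/ edge_dir g T i 0 (-1)
}.

Lemma polygon_orth_loop (L : R) (g : R -> pt) :
  ccw_simple_orthogonal_polygon L g -> exists n T, orth_loop L g n T.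
Proof.
  intros [HL [Hper [Hinj [n [tb [Htb0 [Htbn [Hlt [Hedge _]]]]]]]]].
  assert (Hn : (0 < n)%nat).
  { destruct n; [rewrite Htb0 in Htbn; lra|lia]. }
  pose proof (period_mult g L Hper) as Hk.
  set (T := fun i => tb (i mod n)%nat + INR (i / n) * L).
  (* This also holds at the wrap-around, where [tb n = L] stands for [tb 0] of the next period. *)
  assert (HT : forall i, T (S i) = tb (S (i mod n)) + INR (i / n) * L).
  { intros i. unfold T.
    pose proof (Nat.mod_upper_bound i n ltac:(lia)) as Hr.
    pose proof (Nat.div_mod i n ltac:(lia)) as Hi.
    destruct (Nat.eq_dec (S (i mod n)) n) as [Heq|Hne].
    - assert (S i / n = S (i / n) /\ S i mod n = 0)%nat as [-> ->].
      { split; symmetry.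
        - apply (Nat.div_unique _ _ _ 0); lia.
        - apply (Nat.mod_unique _ _ (S (i / n))); lia. }
      rewrite Heq, Htb0, Htbn, S_INR. ring.
    - assert (S i / n = i / n /\ S i mod n = S (i mod n))%nat as [-> ->].
      { split; symmetry.
        - apply (Nat.div_unique _ _ _ (S (i mod n))); lia.
        - apply (Nat.mod_unique _ _ (i / n)); lia. }
      reflexivity. }
  exists n, T. split; try assumption.
  - intros t u Htu Heq.
    destruct (shift_into_period L t 0 HL) as [k Hk0].
    rewrite <- (Hk k t), <- (Hk k u) in Heq.
    destruct (Rlt_le_dec (u + IZR k * L) L).
    + apply Hinj in Heq; lra.
    + replace (u + IZR k * L) with (u + IZR k * L - L + L) in Heq by ring.
      rewrite Hper in Heq.
      apply Hinj in Heq; lra.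
  - unfold T. rewrite Nat.Div0.mod_0_l, Nat.Div0.div_0_l, Htb0. simpl. ring.
  - intros i. rewrite HT. unfold T.
    pose proof (Hlt (i mod n)%nat (Nat.mod_upper_bound i n ltac:(lia))). lra.
  - intros i. unfold T.
    replace (i + n)%nat with (i + 1 * n)%nat by lia.
    rewrite Nat.Div0.mod_add, Nat.div_add by lia. rewrite plus_INR. simpl. ring.
  - intros i.
    destruct (Hedge (i mod n)%nat (Nat.mod_upper_bound i n ltac:(lia)))
      as [dx [dy [Hd H]]].
    assert (He : edge_dir g T i dx dy).
    { intros t Ht. rewrite HT in Ht. unfold T in *.
      assert (Hi : forall w, g (w + INR (i / n) * L) = g w)
        by (intros w; rewrite INR_IZR_INZ; apply Hk).
      rewrite Hi.
      replace (g t) with (g (t - INR (i / n) * L))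
        by (rewrite <- (Hi (t - INR (i / n) * L)); f_equal; ring).
      rewrite H by lra. f_equal; f_equal; ring. }
    destruct Hd as [[-> [-> | ->]]|[-> [-> | ->]]]; tauto.
Qed.

(** Reflection in the vertical axis keeps parameters, heights and distances, hence chases, and turns
    leftward edges into rightward ones. *)
Definition mirror (g : R -> pt) (t : R) : pt := (- fst (g t), snd (g t)).

Lemma edist_mirror (g : R -> pt) (t u : R) :
  edist (mirror g t) (mirror g u) = edist (g t) (g u).
Proof. unfold edist, mirror. simpl fst. simpl snd. f_equal. ring. Qed.

Lemma mirror_valid_chase (g : R -> pt) (s p : R -> R) :
  valid_chase g s p -> valid_chase (mirror g) s p.
Proof.
  intros [Hs [Hp [Hmon Hrun]]]. repeat split; try assumption.
  intros tau Htau Hnot.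
  destruct (Hrun tau Htau) as [d [Hd [dir [Hdir H]]]].
  { intros [eps [Heps Hmin]]. apply Hnot. exists eps. split; [exact Heps|].
    intros u Hu. rewrite !edist_mirror. apply Hmin. exact Hu. }
  exists d. split; [exact Hd|]. exists dir. split; [exact Hdir|].
  intros a b Ha Hab Hb Hb1. rewrite !edist_mirror. apply H; assumption.
Qed.

Lemma mirror_eq (g : R -> pt) (t u : R) : mirror g t = mirror g u -> g t = g u.
Proof.
  unfold mirror. intros [= Hx Hy]. rewrite (surjective_pairing (g t)),
    (surjective_pairing (g u)). f_equal; lra.
Qed.

Lemma mirror_edge_dir (g : R -> pt) (T : nat -> R) (i : nat) (dx dy : R) :
  edge_dir g T i dx dy -> edge_dir (mirror g) T i (- dx) dy.
Proof.
  intros H t Ht. unfold mirror. rewrite (H t Ht). simpl. f_equal. ring.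
Qed.

Lemma mirror_edge_dir_inv (g : R -> pt) (T : nat -> R) (i : nat) (dx dy : R) :
  edge_dir (mirror g) T i (- dx) dy -> edge_dir g T i dx dy.
Proof.
  intros H t Ht. specialize (H t Ht). unfold mirror in H. simpl in H.
  injection H as Hx Hy. rewrite (surjective_pairing (g t)). f_equal; lra.
Qed.

Lemma mirror_orth_loop (L : R) (g : R -> pt) (n : nat) (T : nat -> R) :
  orth_loop L g n T -> orth_loop L (mirror g) n T.
Proof.
  intros [HL Hn Hper Hinj H0 Hlt Hsh Hedge]. split; try assumption.
  - intros t. unfold mirror. rewrite Hper. reflexivity.
  - intros t u Htu Heq. apply Hinj; [exact Htu|]. apply mirror_eq. exact Heq.
  - intros i. destruct (Hedge i) as [H|[H|[H|H]]]; apply mirror_edge_dir in H.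
    + right; left. exact H.
    + left. replace (- -1) with 1 in H by ring. exact H.
    + right; right; left. replace (- 0) with 0 in H by ring. exact H.
    + right; right; right. replace (- 0) with 0 in H by ring. exact H.
Qed.

(** * Continuity of the track and consecutive edges *)

Lemma loop_mono (L : R) (g : R -> pt) (n : nat) (T : nat -> R) (i j : nat) :
  orth_loop L g n T -> (i <= j)%nat -> T i <= T j.
Proof.
  intros HO Hij. induction Hij as [|j Hij IH]; [lra|].
  pose proof (loop_lt _ _ _ _ HO j). lra.
Qed.

Lemma loop_vertex_shift (L : R) (g : R -> pt) (n : nat) (T : nat -> R) (i : nat) :
  orth_loop L g n T -> g (T (i + n)%nat) = g (T i).
Proof.
  intros HO. rewrite (loop_shift _ _ _ _ HO). apply (loop_per _ _ _ _ HO).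
Qed.

(** The index starts at [S i] so that the edge containing the shifted parameter always has a
    predecessor, as a two-sided neighbourhood of a vertex requires. *)
Lemma loop_cover (L : R) (g : R -> pt) (n : nat) (T : nat -> R) (t : R) :
  orth_loop L g n T ->
  exists (k : Z) (i : nat), T (S i) <= t + IZR k * L < T (S (S i)).
Proof.
  intros HO. pose proof HO as [HL Hn _ _ H0 _ Hsh _].
  destruct (shift_into_period L t (T 1%nat) HL) as [k Hk].
  exists k. set (t' := t + IZR k * L) in *.
  assert (Hfind : forall m, t' < T (S m) -> exists i, T (S i) <= t' < T (S (S i))).
  { induction m as [|m IH]; intros Hlt.
    - lra.
    - destruct (Rlt_le_dec t' (T (S m))); [auto|]. exists m. lra. }
  apply (Hfind n). change (S n) with (1 + n)%nat. rewrite Hsh. lra.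
Qed.

Lemma edge_lipschitz (L : R) (g : R -> pt) (n : nat) (T : nat -> R) (i : nat) (t u : R) :
  orth_loop L g n T -> T i <= t <= T (S i) -> T i <= u <= T (S i) ->
  Rabs (fst (g t) - fst (g u)) <= Rabs (t - u) /\
  Rabs (snd (g t) - snd (g u)) <= Rabs (t - u).
Proof.
  intros HO Ht Hu.
  destruct (loop_edge _ _ _ _ HO i) as [H|[H|[H|H]]];
    rewrite (H t Ht), (H u Hu); simpl fst; simpl snd;
    unfold Rabs; repeat destruct (Rcase_abs _); lra.
Qed.

Lemma loop_locally_lipschitz (L : R) (g : R -> pt) (n : nat) (T : nat -> R) (t : R) :
  orth_loop L g n T ->
  exists d, 0 < d /\ forall u, Rabs (u - t) < d ->
    Rabs (fst (g u) - fst (g t)) <= Rabs (u - t) /\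
    Rabs (snd (g u) - snd (g t)) <= Rabs (u - t).
Proof.
  intros HO. destruct (loop_cover L g n T t HO) as [k [i Hi]].
  pose proof (period_mult g L (loop_per _ _ _ _ HO) k) as Hk.
  pose proof (loop_lt _ _ _ _ HO i) as Hlt.
  set (t' := t + IZR k * L) in *.
  exists (Rmin (T (S (S i)) - t') (T (S i) - T i)).
  split; [apply Rmin_pos; lra|]. intros u Hu.
  pose proof (Rmin_l (T (S (S i)) - t') (T (S i) - T i)).
  pose proof (Rmin_r (T (S (S i)) - t') (T (S i) - T i)).
  rewrite <- (Hk u), <- (Hk t). fold t'.
  set (u' := u + IZR k * L).
  replace (u - t) with (u' - t') in * by (unfold u', t'; ring).
  apply Rabs_def2 in Hu.
  destruct (Rlt_le_dec u' (T (S i))).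
  - destruct (edge_lipschitz L g n T i u' (T (S i)) HO) as [H1 H2]; [lra|lra|].
    destruct (edge_lipschitz L g n T (S i) (T (S i)) t' HO) as [H3 H4]; [lra|lra|].
    rewrite (Rabs_left (u' - T (S i))) in * by lra.
    rewrite (Rabs_left1 (T (S i) - t')) in * by lra.
    rewrite (Rabs_left (u' - t')) by lra.
    split; [replace (fst (g u') - fst (g t')) with
              ((fst (g u') - fst (g (T (S i)))) + (fst (g (T (S i))) - fst (g t'))) by ring
           |replace (snd (g u') - snd (g t')) with
              ((snd (g u') - snd (g (T (S i)))) + (snd (g (T (S i))) - snd (g t'))) by ring];
      (eapply Rle_trans; [apply Rabs_triang|lra]).
  - apply (edge_lipschitz L g n T (S i)); [exact HO|lra|lra].
Qed.

Lemma loop_continuity (L : R) (g : R -> pt) (n : nat) (T : nat -> R) :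
  orth_loop L g n T ->
  continuity (fun t => fst (g t)) /\ continuity (fun t => snd (g t)).
Proof.
  intros HO. split; intros t eps Heps;
    destruct (loop_locally_lipschitz L g n T t HO) as [d [Hd H]];
    exists (Rmin d eps); (split; [apply Rmin_pos; lra|]);
    intros u [_ Hu]; simpl in *; unfold Rdist in *;
    pose proof (Rmin_l d eps); pose proof (Rmin_r d eps);
    destruct (H u); lra.
Qed.

(** The points at parameter distance [e] before and after the common vertex would coincide;
    [e <= L / 4] keeps both parameters within one injectivity window. *)
Lemma no_backtrack (L : R) (g : R -> pt) (n : nat) (T : nat -> R) (i : nat) (dx dy : R) :
  orth_loop L g n T -> edge_dir g T i dx dy -> edge_dir g T (S i) (- dx) (- dy) -> False.
Proof.
  intros HO H1 H2. pose proof HO as [HL _ _ Hinj _ Hlt _ _].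
  pose proof (Hlt i). pose proof (Hlt (S i)).
  set (e := Rmin (L / 4) (Rmin (T (S i) - T i) (T (S (S i)) - T (S i)))).
  assert (He : 0 < e) by (repeat apply Rmin_pos; lra).
  assert (He1 : e <= L / 4) by apply Rmin_l.
  assert (He2 : e <= T (S i) - T i /\ e <= T (S (S i)) - T (S i)).
  { split; (eapply Rle_trans; [apply Rmin_r|]); [apply Rmin_l|apply Rmin_r]. }
  assert (T (S i) - e = T (S i) + e); [|lra].
  apply Hinj; [lra|].
  rewrite (H2 (T (S i) + e)), (H1 (T (S i) - e)), (H1 (T (S i))) by lra.
  simpl. f_equal; ring.
Qed.

Lemma edge_end (g : R -> pt) (T : nat -> R) (i : nat) (dx dy : R) :
  (forall i, T i < T (S i)) -> edge_dir g T i dx dy ->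
  fst (g (T (S i))) = fst (g (T i)) + (T (S i) - T i) * dx /\
  snd (g (T (S i))) = snd (g (T i)) + (T (S i) - T i) * dy.
Proof.
  intros Hlt H. pose proof (Hlt i). rewrite (H (T (S i))) by lra. split; reflexivity.
Qed.

(** * Extreme bottom vertices and the edges around them *)

Definition lower_right (g : R -> pt) (T : nat -> R) (v : nat) : Prop :=
  forall k, snd (g (T v)) <= snd (g (T k)) /\
            (snd (g (T k)) = snd (g (T v)) -> fst (g (T k)) <= fst (g (T v))).

Lemma lower_right_exists (L : R) (g : R -> pt) (n : nat) (T : nat -> R) :
  orth_loop L g n T -> exists v, (v < n)%nat /\ lower_right g T v.
Proof.
  intros HO. pose proof (loop_size _ _ _ _ HO) as Hn.
  assert (Hfin : forall m, exists v, (v <= m)%nat /\ forall k, (k <= m)%nat ->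
    snd (g (T v)) <= snd (g (T k)) /\
    (snd (g (T k)) = snd (g (T v)) -> fst (g (T k)) <= fst (g (T v)))).
  { induction m as [|m [v [Hv IH]]].
    - exists 0%nat. split; [lia|]. intros k Hk. replace k with 0%nat by lia. lra.
    - destruct (Rlt_le_dec (snd (g (T (S m)))) (snd (g (T v)))) as [Hlt|Hle].
      + exists (S m). split; [lia|]. intros k Hk.
        destruct (Nat.eq_dec k (S m)) as [->|]; [lra|].
        destruct (IH k ltac:(lia)). lra.
      + destruct (Rlt_le_dec (fst (g (T v))) (fst (g (T (S m))))) as [Hx|Hx];
          destruct (Req_dec (snd (g (T (S m)))) (snd (g (T v)))) as [Hy|Hy].
        1: { exists (S m). split; [lia|]. intros k Hk.
             destruct (Nat.eq_dec k (S m)) as [->|]; [lra|].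
             destruct (IH k ltac:(lia)). rewrite Hy. lra. }
        all: exists v; split; [lia|]; intros k Hk;
             destruct (Nat.eq_dec k (S m)) as [->|]; [lra|];
             apply IH; lia. }
  destruct (Hfin (pred n)) as [v [Hv H]].
  exists v. split; [lia|]. intros k.
  induction k as [k IH] using (well_founded_induction Wf_nat.lt_wf).
  destruct (Nat.lt_ge_cases k n); [apply H; lia|].
  replace k with (k - n + n)%nat by lia. rewrite (loop_vertex_shift L) by exact HO.
  apply IH. lia.
Qed.

Lemma lower_right_shift (L : R) (g : R -> pt) (n : nat) (T : nat -> R) (v : nat) :
  orth_loop L g n T -> lower_right g T v -> lower_right g T (v + n).
Proof.
  intros HO H k. rewrite (loop_vertex_shift L) by exact HO. apply H.
Qed.

(** Both coordinates are affine on an edge, so extremality among vertices passes to all points of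
    the track. *)
Lemma lower_right_track (L : R) (g : R -> pt) (n : nat) (T : nat -> R) (v : nat) (t : R) :
  orth_loop L g n T -> lower_right g T v ->
  snd (g (T v)) <= snd (g t) /\
  (snd (g t) = snd (g (T v)) -> fst (g t) <= fst (g (T v))).
Proof.
  intros HO Hv. destruct (loop_cover L g n T t HO) as [k [i Hi]].
  rewrite <- (period_mult g L (loop_per _ _ _ _ HO) k t).
  set (t' := t + IZR k * L) in *.
  pose proof (Hv (S i)) as [H1 H2]. pose proof (Hv (S (S i))) as [H3 H4].
  destruct (loop_edge _ _ _ _ HO (S i)) as [H|[H|[H|H]]];
    destruct (edge_end g T (S i) _ _ (loop_lt _ _ _ _ HO) H) as [Hx Hy];
    rewrite (H t') by lra; simpl fst; simpl snd; lra.
Qed.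

(** Consecutive edges may be collinear, so the bottom segment is followed backwards from [S v]. The
    preceding edge either prolongs it or descends into it, which gives the barrier; a leftward edge
    would backtrack and an upward one would start below the bottom. Prolonging [n] times would close
    the loop with an abscissa increased by [L]. The bound [n <= v] keeps the subtractions of indices
    exact. *)
Lemma rightward_bottom_barrier (L : R) (g : R -> pt) (n : nat) (T : nat -> R) (v : nat) :
  orth_loop L g n T -> (n <= v)%nat -> lower_right g T (S v) ->
  edge_dir g T v 1 0 -> exists a b eta, barrier g a b eta.
Proof.
  intros HO Hnv Hlr Hv. pose proof HO as [HL Hn Hper Hinj H0 Hlt Hsh Hedge].
  set (chain := fun m => forall t, T (S v - m)%nat <= t <= T (S v) ->
    g t = (fst (g (T (S v - m)%nat)) + (t - T (S v - m)%nat), snd (g (T (S v))))).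
  assert (Hchain : forall m, (S m <= n)%nat ->
            (exists a b eta, barrier g a b eta) \/ chain (S m)).
  { induction m as [|m IH]; intros Hm.
    - right. intros t. replace (S v - 1)%nat with v by lia. intros Ht.
      destruct (edge_end g T v _ _ Hlt Hv) as [_ Hy]. rewrite (Hv t Ht), Hy.
      f_equal; ring.
    - destruct (IH ltac:(lia)) as [Hb|Hc]; [left; exact Hb|].
      set (j := (S v - S (S m))%nat).
      assert (Hj : (S v - S m)%nat = S j) by lia.
      unfold chain in Hc |- *. rewrite Hj in Hc. fold j.
      assert (Hjv : T (S (S j)) <= T (S v)) by (apply (loop_mono L g n); [exact HO|lia]).
      pose proof (Hlt j) as Hltj. pose proof (Hlt (S j)) as HltSj.
      assert (Hyj : snd (g (T (S j))) = snd (g (T (S v))))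
        by (rewrite (Hc (T (S j))) by lra; reflexivity).
      assert (HSj : edge_dir g T (S j) 1 0).
      { intros t Ht. rewrite (Hc t) by lra. rewrite Hyj. f_equal; ring. }
      pose proof (Hlr j) as [Hlow Hr].
      destruct (Hedge j) as [H|[H|[H|H]]];
        destruct (edge_end g T j _ _ Hlt H) as [Hx Hy].
      + right. intros t Ht. destruct (Rle_lt_dec (T (S j)) t).
        * rewrite (Hc t) by lra. rewrite Hx. f_equal. ring.
        * rewrite (H t) by lra. rewrite <- Hyj, Hy. f_equal; ring.
      + exfalso. apply (no_backtrack L g n T j (-1) 0 HO H).
        replace (- -1) with 1 by ring. replace (- 0) with 0 by ring. exact HSj.
      + exfalso. lra.
      + left. exists (T (S j)), (T (S v)), (T (S j) - T j).
        split; [lra|lra| | | |].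
        * intros t Ht. rewrite (H t), Hx, Hy by lra. f_equal; ring.
        * intros t Ht. rewrite Hyj. apply Hc. exact Ht.
        * intros t. rewrite Hyj. apply (lower_right_track L g n T (S v) t HO Hlr).
        * intros t Ht. rewrite Hyj in Ht.
          apply (lower_right_track L g n T (S v) t HO Hlr). exact Ht. }
  destruct (Hchain (pred n) ltac:(lia)) as [Hb|Hc]; [exact Hb|exfalso].
  unfold chain in Hc. replace (S (pred n)) with n in Hc by lia.
  assert (Hs := loop_vertex_shift L g n T (S v - n) HO).
  assert (Ht := Hsh (S v - n)%nat).
  replace (S v - n + n)%nat with (S v) in Hs, Ht by lia.
  specialize (Hc (T (S v)) ltac:(lra)). rewrite <- Hs in Hc.
  apply (f_equal fst) in Hc. cbn [fst] in Hc. lra.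
Qed.

(** Extremality of [S v] leaves only a rightward or a downward incoming edge. After a downward one,
    the outgoing edge cannot go right or down by extremality, nor up by simplicity. *)
Lemma barrier_or_leftward_bottom (L : R) (g : R -> pt) (n : nat) (T : nat -> R) (v : nat) :
  orth_loop L g n T -> (n <= v)%nat -> lower_right g T (S v) ->
  (exists a b eta, barrier g a b eta) \/
  (edge_dir g T v 0 (-1) /\ edge_dir g T (S v) (-1) 0).
Proof.
  intros HO Hnv Hlr. pose proof HO as [HL Hn Hper Hinj H0 Hlt Hsh Hedge].
  pose proof (Hlr v) as [Hi1 Hi2]. pose proof (Hlr (S (S v))) as [Ho1 Ho2].
  pose proof (Hlt v) as Hlt1. pose proof (Hlt (S v)) as Hlt2.
  destruct (Hedge v) as [H|[H|[H|H]]];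
    destruct (edge_end g T v _ _ Hlt H) as [Hx Hy]; try (exfalso; lra).
  - left. exact (rightward_bottom_barrier L g n T v HO Hnv Hlr H).
  - right. split; [exact H|].
    destruct (Hedge (S v)) as [H'|[H'|[H'|H']]];
      destruct (edge_end g T (S v) _ _ Hlt H') as [Hx' Hy']; try (exfalso; lra).
    + exact H'.
    + exfalso. apply (no_backtrack L g n T v 0 (-1) HO H).
      replace (- -1) with 1 by ring. replace (- 0) with 0 by ring. exact H'.
Qed.

(** * Signed ray crossings, replacing the winding number *)

Definition lt01 (a b : R) : R := if Rlt_dec a b then 1 else 0.
Definition le01 (a b : R) : R := if Rle_dec a b then 1 else 0.

(* Signed number of edges of the chain of vertices [i], ..., [i + m] that cross the upward
   vertical ray from [(u, v)]; abscissas are half-open, so that a vertex on the ray is not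
   counted twice. *)
Fixpoint crossings (x y : nat -> R) (i m : nat) (u v : R) : R :=
  match m with
  | O => 0
  | S m' => crossings x y i m' u v +
      (lt01 u (x (S (i + m'))) - lt01 u (x (i + m')%nat)) * le01 v (y (i + m')%nat)
  end.

(** Summation by parts: [D] is supported on vertices with abscissa in the swept interval, where the
    middle hypothesis makes the difference telescope. The last two hypotheses kill the boundary
    terms. *)
Lemma crossings_horizontal_move (x y : nat -> R) (i m : nat) (u u' v : R) :
  u <= u' ->
  (forall k, (i <= k < i + m)%nat -> u < x (S k) <= u' ->
     le01 v (y k) = le01 v (y (S k))) ->
  (u < x i <= u' -> le01 v (y i) = 0) ->
  (u < x (i + m)%nat <= u' -> le01 v (y (i + m)%nat) = 0) ->
  crossings x y i m u v = crossings x y i m u' v.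
Proof.
  intros Huu Hmid Hfirst Hlast.
  set (D := fun k => lt01 u (x k) - lt01 u' (x k)).
  assert (HD : forall k, D k <> 0 -> u < x k <= u').
  { intros k. unfold D, lt01. destruct (Rlt_dec u (x k)), (Rlt_dec u' (x k)); lra. }
  assert (Hsum : crossings x y i m u v - crossings x y i m u' v =
                 D (i + m)%nat * le01 v (y (i + m)%nat) - D i * le01 v (y i)).
  { clear Hlast. induction m as [|m IH]; simpl.
    - rewrite Nat.add_0_r. ring.
    - assert (IH' := IH ltac:(intros k Hk; apply Hmid; lia)).
      rewrite Nat.add_succ_r.
      destruct (Req_dec (D (S (i + m))) 0) as [Hz|Hz].
      + rewrite Hz. unfold D in *. nra.
      + rewrite <- (Hmid (i + m)%nat ltac:(lia) (HD _ Hz)). unfold D in *. nra. }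
  destruct (Req_dec (D i) 0) as [H1|H1]; [rewrite H1 in Hsum|rewrite (Hfirst (HD _ H1)) in Hsum];
    (destruct (Req_dec (D (i + m)%nat) 0) as [H2|H2];
     [rewrite H2 in Hsum|rewrite (Hlast (HD _ H2)) in Hsum]); lra.
Qed.

(** Only a summand with [v <= y k < v'] could change, and its abscissa factor vanishes. *)
Lemma crossings_vertical_move (x y : nat -> R) (i m : nat) (u v v' : R) :
  v <= v' ->
  (forall k, (i <= k < i + m)%nat -> v <= y k < v' ->
     lt01 u (x k) = lt01 u (x (S k))) ->
  crossings x y i m u v = crossings x y i m u v'.
Proof.
  intros Hvv H. induction m as [|m IH]; simpl; [reflexivity|].
  rewrite IH by (intros k Hk; apply H; lia). f_equal.
  unfold le01. specialize (H (i + m)%nat ltac:(lia)).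
  destruct (Rle_dec v (y (i + m)%nat)), (Rle_dec v' (y (i + m)%nat));
    try lra; rewrite H by lra; ring.
Qed.

Lemma crossings_bottom (x y : nat -> R) (i m : nat) (u v : R) :
  (forall k, (i <= k < i + m)%nat -> v <= y k) ->
  crossings x y i m u v = lt01 u (x (i + m)%nat) - lt01 u (x i).
Proof.
  intros H. induction m as [|m IH]; simpl.
  - rewrite Nat.add_0_r. ring.
  - rewrite IH by (intros k Hk; apply H; lia). rewrite Nat.add_succ_r.
    unfold le01. specialize (H (i + m)%nat ltac:(lia)).
    destruct (Rle_dec v (y (i + m)%nat)); lra.
Qed.

Lemma edge_at_height (L : R) (g : R -> pt) (n : nat) (T : nat -> R) (k : nat) (v : R) :
  orth_loop L g n T -> snd (g (T k)) <> snd (g (T (S k))) ->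
  fst (g (T (S k))) = fst (g (T k)) /\
  (Rmin (snd (g (T k))) (snd (g (T (S k)))) <= v <=
     Rmax (snd (g (T k))) (snd (g (T (S k)))) ->
   exists t, T k <= t <= T (S k) /\ g t = (fst (g (T k)), v)).
Proof.
  intros HO Hne. pose proof (loop_lt _ _ _ _ HO k).
  destruct (loop_edge _ _ _ _ HO k) as [H'|[H'|[H'|H']]];
    destruct (edge_end g T k _ _ (loop_lt _ _ _ _ HO) H') as [Hx Hy];
    try (exfalso; lra);
    (split; [lra|]); intros Hv.
  - rewrite Rmin_left, Rmax_right in Hv by lra.
    exists (T k + (v - snd (g (T k)))). split; [lra|].
    rewrite H' by lra. f_equal; ring.
  - rewrite Rmin_right, Rmax_left in Hv by lra.
    exists (T k + (snd (g (T k)) - v)). split; [lra|].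
    rewrite H' by lra. f_equal; ring.
Qed.

Lemma edge_at_abscissa (L : R) (g : R -> pt) (n : nat) (T : nat -> R) (k : nat) (u : R) :
  orth_loop L g n T -> fst (g (T k)) <> fst (g (T (S k))) ->
  snd (g (T (S k))) = snd (g (T k)) /\
  (Rmin (fst (g (T k))) (fst (g (T (S k)))) <= u <=
     Rmax (fst (g (T k))) (fst (g (T (S k)))) ->
   exists t, T k <= t <= T (S k) /\ g t = (u, snd (g (T k)))).
Proof.
  intros HO Hne. pose proof (loop_lt _ _ _ _ HO k).
  destruct (loop_edge _ _ _ _ HO k) as [H'|[H'|[H'|H']]];
    destruct (edge_end g T k _ _ (loop_lt _ _ _ _ HO) H') as [Hx Hy];
    try (exfalso; lra);
    (split; [lra|]); intros Hv.
  - rewrite Rmin_left, Rmax_right in Hv by lra.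
    exists (T k + (u - fst (g (T k)))). split; [lra|].
    rewrite H' by lra. f_equal; ring.
  - rewrite Rmin_right, Rmax_left in Hv by lra.
    exists (T k + (fst (g (T k)) - u)). split; [lra|].
    rewrite H' by lra. f_equal; ring.
Qed.

(** The count can change only if the base point of the ray meets an edge of the chain, excluded by
    disjointness, or if the ray sweeps over an end of the chain. The ends have minimal height, so an
    end at or above the base point would lie on the edge itself. *)
Lemma crossings_along_disjoint_edge (L : R) (g : R -> pt) (n : nat) (T : nat -> R)
    (i m r : nat) :
  orth_loop L g n T ->
  (forall t t', T i <= t <= T (i + m)%nat -> T r <= t' <= T (S r) -> g t <> g t') ->
  (forall k, snd (g (T i)) <= snd (g (T k))) ->
  snd (g (T (i + m)%nat)) = snd (g (T i)) ->
  let x := fun k => fst (g (T k)) in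
  let y := fun k => snd (g (T k)) in
  crossings x y i m (x r) (y r) = crossings x y i m (x (S r)) (y (S r)).
Proof.
  intros HO Hdis Hlow Hend x y.
  assert (Hedge : forall k t, (i <= k < i + m)%nat -> T k <= t <= T (S k) ->
            T i <= t <= T (i + m)%nat).
  { intros k t Hk Ht.
    pose proof (loop_mono L g n T i k HO ltac:(lia)).
    pose proof (loop_mono L g n T (S k) (i + m) HO ltac:(lia)). lra. }
  pose proof (loop_mono L g n T i (i + m) HO ltac:(lia)) as Him.
  destruct (Req_dec (x r) (x (S r))) as [Hx|Hx].
  - destruct (Req_dec (y r) (y (S r))) as [Hy|Hy]; [rewrite <- Hx, <- Hy; reflexivity|].
    rewrite <- Hx.
    assert (Hmove : crossings x y i m (x r) (Rmin (y r) (y (S r))) =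
                    crossings x y i m (x r) (Rmax (y r) (y (S r)))).
    { apply crossings_vertical_move.
      - eapply Rle_trans; [apply Rmin_l|apply Rmax_l].
      - intros k Hk Hyk. apply NNPP. intros Hne.
        assert (Hxk : x k <> x (S k)) by (intros Heq; rewrite Heq in Hne; auto).
        destruct (edge_at_abscissa L g n T k (x r) HO Hxk) as [_ Hpt].
        destruct Hpt as [t [Ht Hgt]].
        { change (Rmin (x k) (x (S k)) <= x r <= Rmax (x k) (x (S k))).
          unfold lt01, Rmin, Rmax in *.
          destruct (Rlt_dec (x r) (x k)), (Rlt_dec (x r) (x (S k))),
            (Rle_dec (x k) (x (S k))); lra. }
        destruct (edge_at_height L g n T r (y k) HO Hy) as [_ Hpt].
        destruct Hpt as [t' [Ht' Hgt']].
        { change (Rmin (y r) (y (S r)) <= y k <= Rmax (y r) (y (S r))). lra. }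
        apply (Hdis t t' (Hedge k t Hk Ht) Ht').
        rewrite Hgt, Hgt'. reflexivity. }
    unfold Rmin, Rmax in Hmove. destruct (Rle_dec (y r) (y (S r)));
      [exact Hmove|symmetry; exact Hmove].
  (* The abscissa [0] is a placeholder; the edge is horizontal in any case. *)
  - destruct (edge_at_abscissa L g n T r 0 HO Hx) as [Hy _].
    change (y (S r) = y r) in Hy. rewrite Hy.
    assert (Hon : forall u, Rmin (x r) (x (S r)) < u <= Rmax (x r) (x (S r)) ->
              exists t', T r <= t' <= T (S r) /\ g t' = (u, y r)).
    { intros u Hu. destruct (edge_at_abscissa L g n T r u HO Hx) as [_ Hpt].
      apply Hpt. fold (x r) (x (S r)). lra. }
    assert (Hvert : forall t, T i <= t <= T (i + m)%nat ->
              Rmin (x r) (x (S r)) < fst (g t) <= Rmax (x r) (x (S r)) ->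
              snd (g t) <> y r).
    { intros t Ht Hu Hs. destruct (Hon _ Hu) as [t' [Ht' Hgt']].
      apply (Hdis t t' Ht Ht'). rewrite Hgt', <- Hs. apply surjective_pairing. }
    assert (Hmove : crossings x y i m (Rmin (x r) (x (S r))) (y r) =
                    crossings x y i m (Rmax (x r) (x (S r))) (y r)).
    { apply crossings_horizontal_move.
      - eapply Rle_trans; [apply Rmin_l|apply Rmax_l].
      - intros k Hk Hu. apply NNPP. intros Hne.
        assert (Hyk : y k <> y (S k)) by (intros Heq; rewrite Heq in Hne; auto).
        destruct (edge_at_height L g n T k (y r) HO Hyk) as [Hxk Hpt].
        destruct Hpt as [t [Ht Hgt]].
        { change (Rmin (y k) (y (S k)) <= y r <= Rmax (y k) (y (S k))).
          unfold le01, Rmin, Rmax in *.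
          destruct (Rle_dec (y r) (y k)), (Rle_dec (y r) (y (S k))),
            (Rle_dec (y k) (y (S k))); lra. }
        apply (Hvert t (Hedge k t Hk Ht)); rewrite Hgt; simpl; [|reflexivity].
        rewrite <- Hxk. exact Hu.
      - intros Hu. specialize (Hvert (T i) ltac:(lra) Hu). pose proof (Hlow r).
        unfold le01. destruct (Rle_dec (y r) (y i)); unfold y in *; lra.
      - intros Hu. specialize (Hvert (T (i + m)%nat) ltac:(lra) Hu).
        pose proof (Hlow r). unfold le01.
        destruct (Rle_dec (y r) (y (i + m)%nat)); unfold y in *; lra. }
    unfold Rmin, Rmax in Hmove. destruct (Rle_dec (x r) (x (S r)));
      [exact Hmove|symmetry; exact Hmove].
Qed.

(* [crossings] for the arc from [i] to [j] is constant along the complementary arc, which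
   avoids it; but it is [-1] just to the right of [j] and [0] just above [i]. *)
Lemma bottom_edges_not_facing (L : R) (g : R -> pt) (n : nat) (T : nat -> R) (i j q : nat) :
  orth_loop L g n T -> (i < j)%nat -> (j < S q)%nat -> (i + n = S q)%nat ->
  lower_right g T i -> lower_right (mirror g) T j ->
  edge_dir g T q 0 (-1) -> edge_dir g T j 1 0 -> False.
Proof.
  intros HO Hij Hjq Hq Hi Hj Hdown Hright.
  pose proof HO as [HL _ _ Hinj _ Hlt Hsh _].
  set (x := fun k => fst (g (T k))). set (y := fun k => snd (g (T k))).
  assert (Hyi : forall k, y i <= y k) by (intros k; apply Hi).
  assert (Hyj : y j = y i).
  { apply Rle_antisym; [exact (proj1 (Hj i))|exact (Hyi j)]. }
  assert (Hxi : forall k, y k = y i -> x k <= x i) by (intros k; apply Hi).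
  assert (Hxj : forall k, y k = y i -> x j <= x k).
  { intros k Hk. destruct (Hj k) as [_ H]. unfold mirror in H. simpl in H.
    fold (x k) (x j) (y k) (y j) in H. lra. }
  destruct (edge_end g T q _ _ Hlt Hdown) as [Hxq Hyq].
  destruct (edge_end g T j _ _ Hlt Hright) as [Hxj1 Hyj1].
  fold (x q) (x (S q)) (y q) (y (S q)) (x j) (x (S j)) (y j) (y (S j)) in *.
  pose proof (Hlt q) as Hltq. pose proof (Hlt j) as Hltj.
  assert (HTq : T (S q) = T i + L) by (rewrite <- Hq; apply Hsh).
  assert (Hgq : g (T (S q)) = g (T i)) by (rewrite <- Hq; apply (loop_vertex_shift L); exact HO).
  assert (HxSq : x (S q) = x i) by (unfold x; rewrite Hgq; reflexivity).
  assert (HySq : y (S q) = y i) by (unfold y; rewrite Hgq; reflexivity).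
  assert (Hjq' : (S j <= q)%nat).
  { destruct (Nat.eq_dec j q) as [->|]; [lra|lia]. }
  pose proof (loop_mono L g n T (S j) q HO Hjq') as HTjq.
  pose proof (loop_mono L g n T i j HO ltac:(lia)) as HTij.
  assert (Hm : exists m, (i + m = j)%nat) by (exists (j - i)%nat; lia).
  destruct Hm as [m Hm].
  set (F := fun r => crossings x y i m (x r) (y r)).
  assert (Hconst : forall r, (S j <= r <= q)%nat -> F r = F (S j)).
  { intros r [H1 H2]. induction H1 as [|r H1 IH]; [reflexivity|].
    rewrite <- IH by lia. symmetry. unfold F, x, y.
    apply (crossings_along_disjoint_edge L g n); [exact HO| |exact Hyi|rewrite Hm; exact Hyj].
    rewrite Hm. intros t t' Ht Ht' Heq.
    pose proof (loop_mono L g n T (S j) r HO ltac:(lia)).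
    pose proof (loop_mono L g n T (S r) q HO ltac:(lia)).
    apply Hinj in Heq; lra. }
  assert (HFj : F (S j) = -1).
  { unfold F. rewrite crossings_bottom by (intros k _; rewrite Hyj1, Hyj; pose proof (Hyi k); lra).
    rewrite Hm.
    assert (Hle : x (S j) <= x i) by (apply Hxi; lra).
    (* Equality would make vertex [S j] coincide with vertex [i] less than one period later. *)
    assert (Hne : x (S j) <> x i).
    { intros Heq. assert (Hp : g (T i) = g (T (S j))).
      { rewrite (surjective_pairing (g (T i))), (surjective_pairing (g (T (S j)))).
        fold (x i) (y i) (x (S j)) (y (S j)). f_equal; lra. }
      apply Hinj in Hp; lra. }
    unfold lt01. destruct (Rlt_dec (x (S j)) (x j)), (Rlt_dec (x (S j)) (x i)); lra. }
  assert (HFi : crossings x y i m (x i) (y i) = 0).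
  { rewrite crossings_bottom by (intros k _; apply Hyi). rewrite Hm.
    specialize (Hxi j Hyj). unfold lt01.
    destruct (Rlt_dec (x i) (x j)), (Rlt_dec (x i) (x i)); lra. }
  assert (HFq : F q = 0).
  { unfold F. replace (x q) with (x i) by lra. rewrite <- HFi. symmetry.
    apply crossings_vertical_move; [apply Hyi|].
    intros k Hk Hyk. apply NNPP. intros Hne.
    assert (Hxk : x k <> x (S k)) by (intros Heq; rewrite Heq in Hne; auto).
    destruct (edge_at_abscissa L g n T k (x i) HO Hxk) as [HySk Hpt].
    change (y (S k) = y k) in HySk.
    (* Edge [q] ends at vertex [i] of the chain, so disjointness fails at bottom height. There the
       edges of the chain lie at abscissas at most [x i] and are not counted. *)
    destruct (Req_dec (y k) (y i)) as [Hyki|Hyki].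
    { apply Hne. pose proof (Hxi k Hyki). pose proof (Hxi (S k) ltac:(lra)).
      unfold lt01. destruct (Rlt_dec (x i) (x k)), (Rlt_dec (x i) (x (S k))); lra. }
    destruct Hpt as [t [Ht Hgt]].
    { change (Rmin (x k) (x (S k)) <= x i <= Rmax (x k) (x (S k))).
      unfold lt01, Rmin, Rmax in *.
      destruct (Rlt_dec (x i) (x k)), (Rlt_dec (x i) (x (S k))),
        (Rle_dec (x k) (x (S k))); lra. }
    set (t' := T q + (y q - y k)).
    assert (Ht' : T q <= t' < T (S q)) by (unfold t'; lra).
    pose proof (loop_mono L g n T i k HO ltac:(lia)).
    pose proof (loop_mono L g n T (S k) j HO ltac:(lia)).
    assert (Heq : g t = g t').
    { rewrite Hgt, (Hdown t') by lra. fold (x q) (y q) (y k). f_equal; unfold t'; lra. }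
    apply Hinj in Heq; lra. }
  rewrite (Hconst q) in HFq by lia. lra.
Qed.

(** * Existence of a barrier and conclusion *)

(** Without a barrier on either side, the rightmost bottom vertex is entered downwards and left
    towards the left, and the leftmost one is left towards the right: the facing configuration
    already excluded. *)
Lemma barrier_exists (L : R) (g : R -> pt) (n : nat) (T : nat -> R) :
  orth_loop L g n T ->
  (exists a b eta, barrier g a b eta) \/ (exists a b eta, barrier (mirror g) a b eta).
Proof.
  intros HO. pose proof (mirror_orth_loop L g n T HO) as HM.
  destruct (lower_right_exists L g n T HO) as [v [Hv Hlv]].
  destruct (lower_right_exists L (mirror g) n T HM) as [w [Hw Hlw]].
  apply NNPP. intros Hno.
  assert (Hleft : forall k, (n < k)%nat -> lower_right g T k ->
            edge_dir g T (pred k) 0 (-1) /\ edge_dir g T k (-1) 0).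
  { intros [|k] Hk Hlk; [lia|].
    destruct (barrier_or_leftward_bottom L g n T k HO ltac:(lia) Hlk); [tauto|assumption]. }
  assert (Hright : forall k, (n < k)%nat -> lower_right (mirror g) T k -> edge_dir g T k 1 0).
  { intros [|k] Hk Hlk; [lia|].
    destruct (barrier_or_leftward_bottom L (mirror g) n T k HM ltac:(lia) Hlk)
      as [|[_ H]]; [tauto|].
    apply mirror_edge_dir_inv. replace (- 1) with (-1) by ring. exact H. }
  assert (Hlv' : forall c, lower_right g T (v + c * n)).
  { induction c; [rewrite Nat.add_0_r; exact Hlv|].
    replace (v + S c * n)%nat with (v + c * n + n)%nat by lia.
    exact (lower_right_shift L g n T _ HO IHc). }
  assert (Hlw' : forall c, lower_right (mirror g) T (w + c * n)).
  { induction c; [rewrite Nat.add_0_r; exact Hlw|].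
    replace (w + S c * n)%nat with (w + c * n + n)%nat by lia.
    exact (lower_right_shift L _ n T _ HM IHc). }
  (* A copy of [w] is placed between two consecutive copies of [v]. The offset [2 * n] makes all
     indices exceed [n], even for [v = 0]. The case [v = w] is impossible, since one edge would
     point both ways. *)
  assert (Hj : exists j, (v + 2 * n < j < v + 3 * n)%nat /\ lower_right (mirror g) T j).
  { destruct (Nat.lt_trichotomy v w) as [Hlt|[Heq|Hgt]].
    - exists (w + 2 * n)%nat. split; [lia|apply Hlw'].
    - exfalso. subst w.
      destruct (Hleft (v + 2 * n)%nat ltac:(lia) (Hlv' _)) as [_ H1].
      pose proof (Hright (v + 2 * n)%nat ltac:(lia) (Hlw' _)) as H2.
      pose proof (loop_lt _ _ _ _ HO (v + 2 * n)) as Hlt.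
      destruct (edge_end g T _ _ _ (loop_lt _ _ _ _ HO) H1) as [E1 _].
      destruct (edge_end g T _ _ _ (loop_lt _ _ _ _ HO) H2) as [E2 _]. lra.
    - exists (w + 3 * n)%nat. split; [lia|apply Hlw']. }
  destruct Hj as [j [Hj Hlj]].
  destruct (Hleft (v + 3 * n)%nat ltac:(lia) (Hlv' _)) as [Hdown _].
  apply (bottom_edges_not_facing L g n T (v + 2 * n) j (pred (v + 3 * n)));
    [exact HO|lia|lia|lia|apply Hlv'|exact Hlj|exact Hdown|].
  apply Hright; [lia|exact Hlj].
Qed.

Theorem theorem2 :
  forall (L : R) (gamma : R -> pt),
    ccw_simple_orthogonal_polygon L gamma ->
    forall s p : R -> R,
      valid_chase gamma s p ->
      s 1 = s 0 + 2 * L ->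
      exists tau, 0 <= tau <= 1 /\ gamma (s tau) = gamma (p tau).
Proof.
  intros L g Hpoly s p Hv Hs1.
  destruct (polygon_orth_loop L g Hpoly) as [n [T HO]].
  destruct (barrier_exists L g n T HO) as [[a [b [eta Hb]]]|[a [b [eta Hb]]]].
  - destruct (loop_continuity L g n T HO) as [Hx Hy].
    exact (barrier_catches L g a b eta s p (loop_pos _ _ _ _ HO)
             (loop_per _ _ _ _ HO) Hx Hy Hb Hv Hs1).
  - pose proof (mirror_orth_loop L g n T HO) as HM.
    destruct (loop_continuity L (mirror g) n T HM) as [Hx Hy].
    destruct (barrier_catches L (mirror g) a b eta s p (loop_pos _ _ _ _ HM)
                (loop_per _ _ _ _ HM) Hx Hy Hb (mirror_valid_chase g s p Hv) Hs1)
      as [tau [Ht Heq]].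
    exists tau. split; [exact Ht|]. apply mirror_eq. exact Heq.
Qed.
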